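(* Let $c_1\ge c_2>0$, $c_3>0$, $0\le v<c_2$, $Q_*>0$, and let $\mathcal P_1,\mathcal P_2\in\mathbb R$ satisfy $$2\Theta:=\frac{\mathcal P_1}{c_1^2}-\frac{\mathcal P_2}{c_2^2}=\nu Q_*,\qquad \nu=c_3\sqrt{\frac{c_1^2+c_2^2-2v^2}{(c_1^2-v^2)(c_2^2-v^2)}}.$$ Put $A_{11}=\mathcal P_1/c_1^2$, $A_{21}=\mathcal P_2/c_2^2$ and $$A_0=\frac{1}{c_1^2+c_2^2-2v^2}\left[\mathcal P_1\left(1-\frac{v^2}{c_1^2}\right)+\mathcal P_2\left(1-\frac{v^2}{c_2^2}\right)\right].$$ Then the global energy release $G=G_{left}+G_{right}$, where $$G_{left}=\mathcal P_1A_{11}+\mathcal P_2A_{21}-\tfrac12\left[A_{11}^2(c_1^2+v^2)+A_{21}^2(c_2^2+v^2)\right],$$ $$G_{right}=-A_0^2(c_1^2+c_2^2)+\tfrac12A_0^2(c_1^2+c_2^2+2v^2),$$ satisfies $$G=\frac{2(c_1^2-v^2)(c_2^2-v^2)}{c_1^2+c_2^2-2v^2}\,\Theta^2=\frac{2c_3^2}{\nu^2}\Theta^2,$$ and it equals the local fracture energy: $G=G_0:=\tfrac12c_3^2Q_*^2$.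
   Context: Setting: steady subsonic splitting, at speed $v$, of two elastic strings (long-wave speeds $c_1,c_2$) connected ahead of the splitting point by distributed bonds of stiffness $c_3^2$ with critical strain $Q_*$. $\mathcal P_1,\mathcal P_2$ are the tensile forces in the separated strings behind the splitting point, $A_{11},A_{21}$ the corresponding strains, and $A_0$ the common strain of the strings far ahead. $G_{left},G_{right}$ are the energy release rates from the left and from the right. *)

(* Defs.v *)
From Stdlib Require Import Reals.
Open Scope R_scope.

(* c1, c2: long-wave speeds of the strings; c3^2: bond stiffness;
   v: splitting speed; P1, P2: tensile forces behind the splitting point.
   The mass density is normalized to 1, so the modulus of string i is ci^2. *)

Definition nu (c1 c2 c3 v : R) : R :=
  c3 * sqrt ((c1 ^ 2 + c2 ^ 2 - 2 * v ^ 2) /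
             ((c1 ^ 2 - v ^ 2) * (c2 ^ 2 - v ^ 2))).

Definition Theta (c1 c2 P1 P2 : R) : R :=
  (P1 / c1 ^ 2 - P2 / c2 ^ 2) / 2.

(* Strain of a separated string with long-wave speed c under the force P:
   A11 = strain c1 P1 and A21 = strain c2 P2. *)
Definition strain (c P : R) : R := P / c ^ 2.

(* Common strain of the strings far ahead of the splitting point. *)
Definition A0 (c1 c2 v P1 P2 : R) : R :=
  / (c1 ^ 2 + c2 ^ 2 - 2 * v ^ 2) *
  (P1 * (1 - v ^ 2 / c1 ^ 2) + P2 * (1 - v ^ 2 / c2 ^ 2)).

(* Energy release rate from the left: work of P1, P2 minus the energy (elastic
   and kinetic) stored in the separated strings. *)
Definition Gleft (c1 c2 v P1 P2 : R) : R :=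
  let A11 := strain c1 P1 in
  let A21 := strain c2 P2 in
  P1 * A11 + P2 * A21
  - / 2 * (A11 ^ 2 * (c1 ^ 2 + v ^ 2) + A21 ^ 2 * (c2 ^ 2 + v ^ 2)).

(* Energy release rate from the right. *)
Definition Gright (c1 c2 v P1 P2 : R) : R :=
  let a0 := A0 c1 c2 v P1 P2 in
  - (a0 ^ 2 * (c1 ^ 2 + c2 ^ 2))
  + / 2 * a0 ^ 2 * (c1 ^ 2 + c2 ^ 2 + 2 * v ^ 2).

Definition Gglobal (c1 c2 v P1 P2 : R) : R :=
  Gleft c1 c2 v P1 P2 + Gright c1 c2 v P1 P2.

(* Local fracture energy: elastic energy of a bond at the critical strain Q. *)
Definition Glocal (c3 Q : R) : R := / 2 * c3 ^ 2 * Q ^ 2.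

(* Main.v *)
Require Import Defs.
From Stdlib Require Import Reals Lra.
Open Scope R_scope.

(** Write [a = c1^2 - v^2], [b = c2^2 - v^2].  In terms of the strains the left
    and right rates are [(a A11^2 + b A21^2) / 2] and [- (a + b) A0^2 / 2], where
    [A0 = (a A11 + b A21) / (a + b)] is the weighted mean of the strains; so [G]
    is half the weighted variance, [a b (A11 - A21)^2 / (2 (a + b))].  The
    fracture criterion and [nu^2 = c3^2 (a + b) / (a b)] turn this into [G0]. *)

Lemma Gglobal_eq_Theta (c1 c2 v P1 P2 : R) :
  c1 <> 0 -> c2 <> 0 -> c1 ^ 2 + c2 ^ 2 - 2 * v ^ 2 <> 0 ->
  Gglobal c1 c2 v P1 P2 =
    2 * (c1 ^ 2 - v ^ 2) * (c2 ^ 2 - v ^ 2) / (c1 ^ 2 + c2 ^ 2 - 2 * v ^ 2)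
    * Theta c1 c2 P1 P2 ^ 2.
Proof.
  intros h1 h2 hs.
  unfold Gglobal, Gleft, Gright, A0, strain, Theta.
  field; auto.
Qed.

(** In the subsonic regime the radicand is a quotient of positive numbers, so squaring removes the
    root. *)
Lemma nu_sqr (c1 c2 c3 v : R) :
  0 < c1 ^ 2 - v ^ 2 -> 0 < c2 ^ 2 - v ^ 2 ->
  nu c1 c2 c3 v ^ 2 =
    c3 ^ 2 * ((c1 ^ 2 + c2 ^ 2 - 2 * v ^ 2) /
              ((c1 ^ 2 - v ^ 2) * (c2 ^ 2 - v ^ 2))).
Proof.
  intros ha hb.
  unfold nu; rewrite Rpow_mult_distr, pow2_sqrt; [reflexivity|].
  apply Rlt_le, Rdiv_lt_0_compat; [lra|].
  now apply Rmult_lt_0_compat.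
Qed.

Theorem mainTheorem2 (c1 c2 c3 v Q P1 P2 : R)
  (hc12 : c1 >= c2) (hc2 : c2 > 0) (hc3 : c3 > 0)
  (hv0 : 0 <= v) (hv : v < c2) (hQ : Q > 0)
  (hcrit : 2 * Theta c1 c2 P1 P2 = nu c1 c2 c3 v * Q) :
  Gglobal c1 c2 v P1 P2 =
    2 * (c1 ^ 2 - v ^ 2) * (c2 ^ 2 - v ^ 2) / (c1 ^ 2 + c2 ^ 2 - 2 * v ^ 2)
    * Theta c1 c2 P1 P2 ^ 2 /\
  Gglobal c1 c2 v P1 P2 =
    2 * c3 ^ 2 / nu c1 c2 c3 v ^ 2 * Theta c1 c2 P1 P2 ^ 2 /\
  Gglobal c1 c2 v P1 P2 = Glocal c3 Q.
Proof.
  (* Both follow from [0 <= v < c2 <= c1]; their sum is the denominator of [A0], hence nonzero. *)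
  assert (ha : 0 < c1 ^ 2 - v ^ 2) by nra.
  assert (hb : 0 < c2 ^ 2 - v ^ 2) by nra.
  rewrite Gglobal_eq_Theta by lra.
  split; [reflexivity|split].
  - rewrite nu_sqr by assumption.
    field; repeat split; lra.
  - replace (Theta c1 c2 P1 P2) with (nu c1 c2 c3 v * Q / 2) by lra.
    (* Isolating [nu ^ 2] lets [nu_sqr] eliminate the square root, leaving a rational identity in
       which the wave speeds cancel. *)
    replace ((nu c1 c2 c3 v * Q / 2) ^ 2)
      with (nu c1 c2 c3 v ^ 2 * Q ^ 2 / 4) by field.
    rewrite nu_sqr by assumption.
    unfold Glocal; field; repeat split; lra.
Qed.
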